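(* Suppose $G$ is a finitely generated group that acts by isometries on a complete CAT(0) space $X$, and let $x_0\in X$ and $A>0$. Then the induced action of $G$ on $(\partial X,d_{A,x_0})$ is by quasi-symmetries; that is, for every $g\in G$ the induced map $\partial X\to\partial X$, $[\gamma]\mapsto[g\gamma]$, is a quasi-symmetry from $(\partial X,d_{A,x_0})$ to itself.
   Context: Geodesic rays are parametrized by arc length on $[0,\infty)$. The boundary $\partial X$ of a complete CAT(0) space $(X,d)$ is the set of equivalence classes of geodesic rays, where rays $\alpha,\alpha'$ are equivalent (asymptotic) if there is a constant $k$ with $d(\alpha(t),\alpha'(t))\le k$ for all $t\ge 0$. For each base point $x_0$, each class has a unique representative ray starting at $x_0$. For $x_0\in X$ and $A>0$, the metric $d_{A,x_0}$ on $\partial X$ is defined as follows: given $[\alpha],[\beta]\in\partial X$ with representative rays $\alpha,\beta$ based at $x_0$, let $a\in(0,\infty)$ be such that $d(\alpha(a),\beta(a))=A$, and set $a=\infty$ if no such $a$ exists; then $d_{A,x_0}([\alpha],[\beta])=1/a$ (with $1/\infty=0$). A map $f:Y\to Z$ between metric spaces is quasi-symmetric if it is not constant and there is a homeomorphism $\eta:[0,\infty)\to[0,\infty)$ such that for all $x,y,z\in Y$ and all $t\ge 0$, $d(x,z)\le t\,d(y,z)$ implies $d(f(x),f(z))\le\eta(t)\,d(f(y),f(z))$. A quasi-symmetry is a quasi-symmetric homeomorphism.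
   Formalization: The formal theorem assumes that the boundary ∂X is not a single point; if ∂X is one point (e.g. X = [0,∞)), the induced map is constant and so not a quasi-symmetry under the given definition. *)

(* Defs.v *)
From HB Require Import structures.
From mathcomp Require Import all_boot all_order all_algebra generic_quotient.
From mathcomp Require Import lra ring.
From mathcomp Require Import all_classical all_reals all_analysis.

Set Implicit Arguments.
Unset Strict Implicit.
Unset Printing Implicit Defensive.

Import Order.TTheory GRing.Theory Num.Theory.
Import numFieldNormedType.Exports.

Local Open Scope classical_set_scope.
Local Open Scope ring_scope.

Section cat0_spaces.
Context {R : realType}.

(* Products carry the sup distance in the library, so the Euclidean distance
   of the comparison plane is spelled out. *)
Definition edist (P Q : R * R) : R :=
  Num.sqrt ((P.1 - Q.1) ^+ 2 + (P.2 - Q.2) ^+ 2).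

Definition segpt (P Q : R * R) (u : R) : R * R :=
  ((1 - u) * P.1 + u * Q.1, (1 - u) * P.2 + u * Q.2).

(* The values of c outside [0, mdist x y] are irrelevant. *)
Definition geodesic (X : metricType R) (x y : X) (c : R -> X) : Prop :=
  [/\ c 0 = x, c (mdist x y) = y &
    forall s t, 0 <= s <= mdist x y -> 0 <= t <= mdist x y ->
      mdist (c s) (c t) = `|s - t|].

(* A geodesic triangle has vertices v 0, v 1, v 2 and sides c i from v i to
   v (i + 1 mod 3); V is its comparison triangle. The comparison point of the
   point of the i-th side at distance u * mdist (v i) (v (i + 1)) from v i is
   segpt (V i) (V (i + 1)) u. *)
Definition CAT0 (X : metricType R) : Prop :=
  (forall x y : X, exists c, geodesic x y c) /\
  (forall (v : 'I_3 -> X) (c : 'I_3 -> R -> X) (V : 'I_3 -> R * R),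
    (forall i, geodesic (v i) (v (ordS i)) (c i)) ->
    (forall i j, edist (V i) (V j) = mdist (v i) (v j)) ->
    forall (i j : 'I_3) (u w : R), 0 <= u <= 1 -> 0 <= w <= 1 ->
      mdist (c i (u * mdist (v i) (v (ordS i))))
            (c j (w * mdist (v j) (v (ordS j)))) <=
      edist (segpt (V i) (V (ordS i)) u) (segpt (V j) (V (ordS j)) w)).

End cat0_spaces.

HB.mixin Record isCAT0 (R : realType) X & Metric R X := {
  cat0P : @CAT0 R X
}.

(* Complete includes a distinguished point in the library; it plays no role
   besides making X nonempty. *)
#[short(type="completeCAT0Type")]
HB.structure Definition CompleteCAT0 (R : realType) :=
  {X of Metric R X & Complete X & isCAT0 R X}.

Section hinge.
Context {R : realType} {X : completeCAT0Type R}.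

Lemma comparison_triangle (a b e : R) : 0 <= a -> 0 <= b -> 0 <= e ->
  a <= b + e -> b <= a + e -> e <= a + b ->
  exists x y, x ^+ 2 + y ^+ 2 = b ^+ 2 /\ 2 * a * x = a ^+ 2 + b ^+ 2 - e ^+ 2.
Proof.
move=> a0 b0 e0 h1 h2 h3; case: (eqVneq a 0) => [az|an0].
  exists b, 0; split; first by ring.
  have -> : e = b by lra.
  by rewrite az; ring.
have ap : 0 < a by rewrite lt0r an0.
pose x := (a ^+ 2 + b ^+ 2 - e ^+ 2) / (2 * a).
have xE : 2 * a * x = a ^+ 2 + b ^+ 2 - e ^+ 2.
  by rewrite /x; field.
have xb : x ^+ 2 <= b ^+ 2.
  have l1 : x <= b.
    rewrite -(ler_pM2l (_ : 0 < 2 * a)) ?xE; last by lra.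
    nra.
  have l2 : - b <= x.
    rewrite -(ler_pM2l (_ : 0 < 2 * a)) ?xE; last by lra.
    nra.
  nra.
exists x, (Num.sqrt (b ^+ 2 - x ^+ 2)); split => //.
by rewrite sqr_sqrtr ?subr_ge0//; ring.
Qed.

Lemma geodesic_rev (x y : X) c : geodesic x y c ->
  geodesic y x (fun t => c (mdist x y - t)).
Proof.
move=> [c0 c1 ci]; rewrite /geodesic (metric_sym y x); split.
- by rewrite subr0.
- by rewrite subrr.
- move=> s t hs ht; rewrite ci ?(distrC s)//; last 2 first.
  + by apply/andP; split; lra.
  + by apply/andP; split; lra.
  by congr (`| _ |); ring.
Qed.

Lemma sqr_edist (P Q : R * R) :
  edist P Q ^+ 2 = (P.1 - Q.1) ^+ 2 + (P.2 - Q.2) ^+ 2.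
Proof. by rewrite sqr_sqrtr// addr_ge0// sqr_ge0. Qed.

Lemma edist_eq (P Q : R * R) d : 0 <= d ->
  (P.1 - Q.1) ^+ 2 + (P.2 - Q.2) ^+ 2 = d ^+ 2 -> edist P Q = d.
Proof. by move=> d0 h; rewrite /edist h sqrtr_sqr ger0_norm. Qed.

Definition tri T (a b c : T) (i : 'I_3) : T :=
  match val i with 0%N => a | 1%N => b | _ => c end.

Lemma cat0_hinge (p q r : X) c c' u w :
  geodesic p q c -> geodesic p r c' -> 0 <= u <= 1 -> 0 <= w <= 1 ->
  mdist (c (u * mdist p q)) (c' (w * mdist p r)) ^+ 2 <=
  (u * mdist p q) ^+ 2 + (w * mdist p r) ^+ 2
  - u * w * (mdist p q ^+ 2 + mdist p r ^+ 2 - mdist q r ^+ 2).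
Proof.
move=> gc gc' hu hw; have [geo cmp] := @cat0P R X.
have [c1 gc1] := geo q r.
have t1 := metric_triangle p r q; have t2 := metric_triangle p q r.
have t3 := metric_triangle q p r.
rewrite (metric_sym r q) in t1; rewrite (metric_sym q p) in t3.
have [x [y [xy1 xy2]]] := comparison_triangle (mdist_ge0 p q)
  (mdist_ge0 p r) (mdist_ge0 q r) t1 t2 t3.
set a := mdist p q in xy1 xy2 *; set b := mdist p r in xy1 xy2 *.
set e := mdist q r in xy1 xy2 *.
have a0 : 0 <= a by exact: mdist_ge0.
have b0 : 0 <= b by exact: mdist_ge0.
have e0 : 0 <= e by exact: mdist_ge0.
have := cmp (tri p q r) (tri c c1 (fun t => c' (mdist p r - t)))
  (tri (0, 0) (a, 0) (x, y)).
have hg i : geodesic (tri p q r i) (tri p q r (ordS i))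
    (tri c c1 (fun t => c' (mdist p r - t)) i).
  by case: i => [[|[|[|//]]]] ? //; exact: geodesic_rev.
have hV i j : edist (tri (0, 0) (a, 0) (x, y) i) (tri (0, 0) (a, 0) (x, y) j) =
    mdist (tri p q r i) (tri p q r j).
  apply: edist_eq; first exact: mdist_ge0.
  by case: i => [[|[|[|//]]]] ?; case: j => [[|[|[|//]]]] ?;
    rewrite /tri /= ?mdistxx -/a -/b -/e ?(metric_sym q p) ?(metric_sym r p)
      ?(metric_sym r q) -/a -/b -/e; nra.
have hw' : 0 <= 1 - w <= 1 by apply/andP; split; lra.
move=> /(_ hg hV ord0 (inord 2) u (1 - w) hu hw').
have -> : inord 2 = @Ordinal 3 2 isT by apply/val_inj; rewrite /= inordK.
rewrite /tri /= -/a (metric_sym r p) -/b.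
rewrite (_ : b - (1 - w) * b = w * b); last by ring.
move=> h.
have : mdist (c (u * a)) (c' (w * b)) ^+ 2 <=
    edist (segpt (0, 0) (a, 0) u) (segpt (x, y) (0, 0) (1 - w)) ^+ 2.
  by rewrite ler_sqr ?nnegrE ?mdist_ge0 ?sqrtr_ge0.
move=> /le_trans; apply; rewrite sqr_edist /=.
rewrite [leLHS](_ : _ = (u * a) ^+ 2 + w ^+ 2 * (x ^+ 2 + y ^+ 2)
  - u * w * (2 * a * x)); last by ring.
by rewrite xy1 xy2 exprMn [leRHS]addrC exprMn addrC.
Qed.

Lemma cat0_convex (p q r : X) c c' u :
  geodesic p q c -> geodesic p r c' -> 0 <= u <= 1 ->
  mdist (c (u * mdist p q)) (c' (u * mdist p r)) <= u * mdist q r.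
Proof.
move=> gc gc' hu; have := cat0_hinge gc gc' hu hu.
rewrite [leRHS](_ : _ = (u * mdist q r) ^+ 2); last by ring.
rewrite ler_sqr ?nnegrE ?mdist_ge0 ?mulr_ge0 ?mdist_ge0//.
by case/andP: hu.
Qed.

End hinge.

Section boundary.
Context {R : realType} (X : metricType R).

(* Rays are functions on R of which only the restriction to [0, +oo) matters;
   the quotient below identifies rays with the same restriction. *)
Record ray : Type := Ray {
  ray_fun :> R -> X;
  ray_isom : forall s t, 0 <= s -> 0 <= t ->
    mdist (ray_fun s) (ray_fun t) = `|s - t|
}.

HB.instance Definition _ := gen_eqMixin ray.
HB.instance Definition _ := gen_choiceMixin ray.

Definition asymptotic (al be : ray) : Prop :=
  exists k, forall t, 0 <= t -> mdist (al t) (be t) <= k.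

Definition asymptoticb (al be : ray) : bool := `[< asymptotic al be >].

Lemma asymptoticxx al : asymptotic al al.
Proof. by exists 0 => t _; rewrite mdistxx. Qed.

Lemma asymptotic_sym al be : asymptotic al be -> asymptotic be al.
Proof. by move=> [k h]; exists k => t t0; rewrite metric_sym h. Qed.

Lemma asymptotic_trans be al ga :
  asymptotic al be -> asymptotic be ga -> asymptotic al ga.
Proof.
move=> [k h] [k' h']; exists (k + k') => t t0.
by rewrite (le_trans (metric_triangle _ (be t) _))// lerD ?h ?h'.
Qed.

Lemma asymptoticb_refl : reflexive asymptoticb.
Proof. by move=> al; apply/asboolP/asymptoticxx. Qed.

Lemma asymptoticb_sym : symmetric asymptoticb.
Proof. by move=> al be; apply/asboolP/asboolP => /asymptotic_sym. Qed.

Lemma asymptoticb_trans : transitive asymptoticb.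
Proof.
move=> be al ga /asboolP h /asboolP h'; apply/asboolP.
exact: asymptotic_trans h h'.
Qed.

Canonical asymptotic_equiv :=
  EquivRel asymptoticb asymptoticb_refl asymptoticb_sym asymptoticb_trans.

Definition boundary : Type := {eq_quot asymptotic_equiv}%qT.

HB.instance Definition _ := Choice.on boundary.
HB.instance Definition _ := EqQuotient.on boundary.

Definition bclass (al : ray) : boundary := (\pi_boundary al)%qT.

Lemma bclass_eqP (al be : ray) : bclass al = bclass be <-> asymptotic al be.
Proof. by split=> [/eqmodP/asboolP|h]//; apply/eqmodP/asboolP. Qed.

Lemma bclassK (xi : boundary) : bclass (repr xi) = xi.
Proof. exact: reprK. Qed.

Definition meets_at (A : R) (x0 : X) (xi zeta : boundary) (a : R) : Prop :=
  0 < a /\ exists al be : ray,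
    [/\ al 0 = x0, be 0 = x0, bclass al = xi, bclass be = zeta &
        mdist (al a) (be a) = A].

(* When X is CAT(0), mdist (al t) (be t) is convex in t and vanishes at 0, so
   at most one time a satisfies meets_at for A > 0. *)
Definition bdist (A : R) (x0 : X) (xi zeta : boundary) : R :=
  if pselect (exists a, meets_at A x0 xi zeta a) is left h
  then (sval (cid h))^-1 else 0.

End boundary.

Section boundary_metric.
Context {R : realType} {X : completeCAT0Type R}.
Implicit Types (al be : ray X) (xi zeta : boundary X).

Lemma ray_geodesic al t : 0 <= t -> mdist (al 0) (al t) = t.
Proof. by move=> t0; rewrite ray_isom// sub0r normrN ger0_norm. Qed.

Lemma ray_geodesicP al t : 0 <= t -> geodesic (al 0) (al t) al.
Proof.
move=> t0; split; rewrite ?ray_geodesic//.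
by move=> s u /andP[s0 _] /andP[u0 _]; rewrite ray_isom.
Qed.

Lemma ray_convex al be s t : al 0 = be 0 -> 0 <= s <= t ->
  t * mdist (al s) (be s) <= s * mdist (al t) (be t).
Proof.
move=> ab /andP[s0 st]; case: (eqVneq t 0) => [tz|tn0].
  have -> : s = 0 by lra.
  by rewrite tz !mul0r.
have t0 : 0 < t by rewrite lt0r tn0 (le_trans s0).
have gb := ray_geodesicP be (ltW t0); rewrite -ab in gb.
have := @cat0_convex _ _ _ _ _ _ _ (s / t) (ray_geodesicP al (ltW t0)) gb.
rewrite ray_geodesic ?(ltW t0)// ab ray_geodesic ?(ltW t0)//.
rewrite divfK// divr_ge0 ?(ltW t0)//= ler_pdivrMr// mul1r => /(_ st).
by rewrite -(ler_pM2l t0) mulrA mulrCA divff// mulr1.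
Qed.

Lemma ray_unique al be : al 0 = be 0 -> asymptotic al be ->
  forall t, 0 <= t -> al t = be t.
Proof.
move=> ab [k hk] s s0; apply: mdist_positivity; apply: contrapT => /eqP d0.
set d := mdist _ _ in d0.
have dp : 0 < d by rewrite lt0r d0 mdist_ge0.
have k0 : 0 <= k by exact: le_trans (mdist_ge0 _ _) (hk s s0).
pose t := s + (s * k + 1) / d.
have q0 : 0 <= (s * k + 1) / d.
  by rewrite divr_ge0 ?(ltW dp)// addr_ge0// mulr_ge0.
have t0 : 0 <= t by rewrite addr_ge0.
have st : 0 <= s <= t by rewrite s0/= lerDl.
have := ray_convex ab st; rewrite -/d.
have : s * mdist (al t) (be t) <= s * k by rewrite ler_wpM2l// hk.
have : t * d = s * d + s * k + 1 by rewrite /t mulrDl divfK ?gt_eqF// addrA.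
have : 0 <= s * d by rewrite mulr_ge0// ltW.
lra.
Qed.

Lemma fan_bound (x p q : X) c c' t : geodesic x p c -> geodesic x q c' ->
  0 <= t -> t <= mdist x p -> t <= mdist x q -> 0 < mdist x p ->
  0 < mdist x q ->
  mdist (c t) (c' t) ^+ 2 * (mdist x p * mdist x q) <=
  t ^+ 2 * (mdist p q ^+ 2 - (mdist x q - mdist x p) ^+ 2).
Proof.
move=> gc gc' t0 tp tq p0 q0.
have hu : 0 <= t / mdist x p <= 1.
  by rewrite divr_ge0 ?(ltW p0)//= ler_pdivrMr// mul1r.
have hw : 0 <= t / mdist x q <= 1.
  by rewrite divr_ge0 ?(ltW q0)//= ler_pdivrMr// mul1r.
have := cat0_hinge gc gc' hu hw.
rewrite !divfK ?gt_eqF//; set a := mdist x p in p0 *; set b := mdist x q in q0 *.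
have ab0 : 0 < a * b by rewrite mulr_gt0.
rewrite -(ler_pM2r ab0) => /le_trans; apply; rewrite le_eqVlt; apply/orP; left.
by apply/eqP; field; rewrite !gt_eqF.
Qed.

Section exists_ray.
Variables (al : ray X) (x1 : X).

Let D := mdist x1 (al 0).
Let l (n : nat) := mdist x1 (al n%:R).
Let c (n : nat) := sval (cid ((@cat0P R X).1 x1 (al n%:R))).
Let cP n : geodesic x1 (al n%:R) (c n) := svalP (cid ((@cat0P R X).1 x1 (al n%:R))).

Let D0 : 0 <= D. Proof. exact: mdist_ge0. Qed.

Let l_ge n : n%:R - D <= l n.
Proof.
have := metric_triangle (al 0) x1 (al n%:R).
by rewrite ray_geodesic// (metric_sym _ x1) -/D -/(l n); lra.
Qed.

Let l_le n : l n <= n%:R + D.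
Proof.
have := metric_triangle x1 (al 0) (al n%:R).
by rewrite ray_geodesic// -/D -/(l n); lra.
Qed.

Let c_bound t n m : 0 <= t -> 2 * D + t + 1 <= n%:R -> (n <= m)%N ->
  mdist (c n t) (c m t) ^+ 2 * n%:R <= 16 * D * t ^+ 2.
Proof.
move=> t0 hn nm; have nm' : n%:R <= m%:R :> R by rewrite ler_nat.
have ln := l_ge n; have lm := l_ge m; have un := l_le n; have um := l_le m.
have d0 := D0.
have tn : t <= l n by lra.
have tm : t <= l m by lra.
have n0 : 0 < l n by lra.
have m0 : 0 < l m by lra.
have np : 0 < n%:R :> R by lra.
have mp : 0 < m%:R :> R by lra.
have := fan_bound (cP n) (cP m) t0 tn tm n0 m0.
rewrite -/(l n) -/(l m).
have -> : mdist (al n%:R) (al m%:R) = m%:R - n%:R.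
  by rewrite ray_isom// distrC ger0_norm// subr_ge0.
set d := mdist _ _ ^+ 2.
have dd0 : 0 <= d by exact: sqr_ge0.
set N := n%:R in hn nm' ln un np *; set M := m%:R in nm' lm um mp *.
have tri1 : l m <= l n + (M - N).
  have := metric_triangle x1 (al N) (al M).
  by rewrite (_ : mdist (al N) (al M) = M - N)// ray_isom ?(ltW np) ?(ltW mp)//
    distrC ger0_norm// subr_ge0.
have e1 : (M - N) ^+ 2 - (l m - l n) ^+ 2 <= 4 * D * M.
  rewrite [leLHS](_ : _ = ((M - N) - (l m - l n)) * ((M - N) + (l m - l n)));
    last by ring.
  have h1 : 0 <= (M - N) - (l m - l n) <= 2 * D by apply/andP; split; lra.
  have h2 : (M - N) + (l m - l n) <= 2 * M by lra.
  case/andP: h1 => h1 h1'.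
  apply: (@le_trans _ _ (((M - N) - (l m - l n)) * (2 * M))).
    by rewrite ler_wpM2l.
  rewrite [leRHS](_ : _ = 2 * D * (2 * M)); last by ring.
  by rewrite ler_wpM2r//; lra.
have e2 : N * M <= 4 * (l n * l m).
  have := ler_pM (ltW np) (ltW mp) (_ : N <= 2 * l n) (_ : M <= 2 * l m).
  have -> : 2 * l n * (2 * l m) = 4 * (l n * l m) by ring.
  by apply; lra.
move=> e3.
rewrite -(ler_pM2r mp).
apply: (@le_trans _ _ (4 * (d * (l n * l m)))).
  by rewrite -mulrA [leRHS]mulrCA ler_wpM2l.
rewrite [leRHS](_ : _ = 4 * (t ^+ 2 * (4 * D * M))); last by ring.
rewrite ler_wpM2l//; apply: (le_trans e3).
by rewrite ler_wpM2l// sqr_ge0.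
Qed.

Let c_cauchy t e : 0 <= t -> 0 < e ->
  exists N : nat, forall n, (N <= n)%N -> mdist (c N t) (c n t) < e.
Proof.
move=> t0 e0.
pose B := (2 * D + t + 1) + (16 * D * t ^+ 2 / e ^+ 2 + 1).
have d0 := D0.
have q0 : 0 <= 16 * D * t ^+ 2 / e ^+ 2.
  by rewrite divr_ge0 ?sqr_ge0// mulr_ge0 ?sqr_ge0// mulr_ge0.
exists (Num.truncn B).+1 => n hn; set N := (Num.truncn B).+1 in hn *.
have BN : B < N%:R by rewrite /N; exact: truncnS_gt.
have h : 2 * D + t + 1 <= N%:R by rewrite /B in BN; lra.
have := c_bound t0 h hn.
set d := mdist _ _ => hd.
rewrite -ltr_sqr ?nnegrE ?mdist_ge0 ?(ltW e0)//.
have Np : 0 < N%:R :> R by lra.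
rewrite -(ltr_pM2r Np); apply: (le_lt_trans hd).
rewrite -ltr_pdivrMl ?exprn_gt0// mulrC.
by rewrite /B in BN; lra.
Qed.

Let c_cvg t : 0 <= t -> cvg (c n t @[n --> \oo]).
Proof.
move=> t0; apply/cauchy_cvgP/cauchy_exP => e e0.
have [N hN] := c_cauchy t0 e0; exists (c N t).
exists N => // n /= Nn.
by rewrite ballEmdist/=; exact: hN.
Qed.

Let b t := lim (c n t @[n --> \oo]).

Let b_near t e : 0 <= t -> 0 < e ->
  \forall n \near \oo, mdist (b t) (c n t) < e.
Proof.
move=> t0 e0; have /metricType_numDomainType.cvgrPdist_lt := c_cvg t0.
exact.
Qed.

Let l_near t : \forall n \near \oo, t <= l n.
Proof.
near=> n; have := l_ge n.
suff : t + D <= n%:R by lra.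
near: n; exact: nbhs_infty_ger.
Unshelve. all: by end_near. Qed.

Let b_isom s t : 0 <= s -> 0 <= t -> mdist (b s) (b t) = `|s - t|.
Proof.
move=> s0 t0.
have key e : 0 < e -> exists n, [/\ mdist (b s) (c n s) < e,
    mdist (b t) (c n t) < e & mdist (c n s) (c n t) = `|s - t|].
  move=> e0; near \oo => n; exists n; split.
  - by near: n; exact: b_near.
  - by near: n; exact: b_near.
  - have [_ _] := cP n; apply.
      by rewrite s0/=; near: n; exact: l_near.
    by rewrite t0/=; near: n; exact: l_near.
apply/eqP; rewrite eq_le; apply/andP; split; apply/ler_addgt0Pl => e e0.
- have [|n [h1 h2 h3]] := key (e / 2); first by rewrite divr_gt0.
  have := metric_triangle (b s) (c n s) (b t).
  have := metric_triangle (c n s) (c n t) (b t).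
  rewrite h3 (metric_sym (c n t)); lra.
- have [|n [h1 h2 h3]] := key (e / 2); first by rewrite divr_gt0.
  rewrite -h3.
  have := metric_triangle (c n s) (b s) (c n t).
  have := metric_triangle (b s) (b t) (c n t).
  rewrite (metric_sym (c n s) (b s)); lra.
Unshelve. all: by end_near. Qed.

Let b0 : b 0 = x1.
Proof.
apply: mdist_positivity; apply/eqP; rewrite eq_le mdist_ge0 andbT.
apply/ler_addgt0Pl => e e0; rewrite addr0.
near \oo => n; have [<- _ _] := cP n; apply/ltW.
by near: n; exact: b_near.
Unshelve. all: by end_near. Qed.

Let c_al n t : 0 <= t <= n%:R -> 0 < n%:R :> R -> t <= l n ->
  mdist (al t) (c n t) <= 2 * D.
Proof.
move=> /andP[t0 tn] n0 tl; have d0 := D0.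
have gl := geodesic_rev (cP n).
have ga := geodesic_rev (ray_geodesicP al (ltW n0)).
have hu : 0 <= 1 - t / n%:R <= 1.
  have : 0 <= t / n%:R <= 1.
    by rewrite divr_ge0 ?(ltW n0)//= ler_pdivrMr// mul1r.
  by move=> /andP[? ?]; apply/andP; split; lra.
have := cat0_convex gl ga hu.
rewrite !(metric_sym (al n%:R)) ray_geodesic ?(ltW n0)// -/D -/(l n).
have -> : n%:R - (1 - t / n%:R) * n%:R = t by field; rewrite gt_eqF.
have -> : l n - (1 - t / n%:R) * l n = t / n%:R * l n by ring.
move=> h.
have h' : (1 - t / n%:R) * D <= D.
  by rewrite -[leRHS]mul1r ler_wpM2r//; case/andP: hu.
have [_ _ ci] := cP n.
have un := l_le n; have ln := l_ge n.
have l0 : 0 <= l n by exact: mdist_ge0.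
have r0 : 0 <= t / n%:R by rewrite divr_ge0// ltW.
have r1 : t / n%:R <= 1 by rewrite ler_pdivrMr// mul1r.
have : mdist (c n (t / n%:R * l n)) (c n t) <= D.
  rewrite ci; last 2 first.
  - by rewrite mulr_ge0//= -[leRHS]mul1r ler_wpM2r.
  - by rewrite t0.
  have -> : t / n%:R * l n - t = t / n%:R * (l n - n%:R).
    by field; rewrite gt_eqF.
  rewrite normrM (ger0_norm r0) -[leRHS]mul1r ler_pM//.
  by rewrite ler_norml; apply/andP; split; lra.
have := metric_triangle (al t) (c n (t / n%:R * l n)) (c n t).
by rewrite (metric_sym (al t) (c n (t / n%:R * l n))); lra.
Qed.

Lemma exists_ray : exists be : ray X, be 0 = x1 /\ asymptotic al be.
Proof.
exists (Ray b_isom); split; first exact: b0.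
exists (2 * D + 1) => t t0 /=.
near \oo => n.
have h1 : mdist (b t) (c n t) < 1 by near: n; exact: b_near.
have h2 : mdist (al t) (c n t) <= 2 * D.
  apply: c_al.
  - by rewrite t0/=; near: n; exact: nbhs_infty_ger.
  - by near: n; exact: nbhs_infty_gtr.
  - by near: n; exact: l_near.
have := metric_triangle (al t) (c n t) (b t).
by rewrite (metric_sym (c n t)); lra.
Unshelve. all: by end_near. Qed.

End exists_ray.

Lemma exists_repr (x0 : X) xi :
  exists al, al 0 = x0 /\ bclass al = xi.
Proof.
have [be [h1 h2]] := exists_ray (repr xi) x0.
exists be; split => //; rewrite -[xi]bclassK.
exact/bclass_eqP/asymptotic_sym.
Qed.

Section bdist_metric.
Variables (A : R) (x0 : X).
Hypothesis A0 : 0 < A.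

Lemma exists_meets al be a : al 0 = be 0 -> 0 < a ->
  A < mdist (al a) (be a) -> exists2 b, 0 < b & mdist (al b) (be b) = A.
Proof.
move=> ab a0 hA; pose f (t : R) := mdist (al `|t|) (be `|t|).
have lip s t : f s <= f t + 2 * `|s - t|.
  have := metric_triangle (al `|s|) (al `|t|) (be `|s|).
  have := metric_triangle (al `|t|) (be `|t|) (be `|s|).
  rewrite !ray_isom// (distrC `|t|) -/(f s) -/(f t).
  by have := ler_dist_dist s t; lra.
have cf : continuous f.
  move=> t; apply/cvgrPdist_le => e e0; near=> s.
  have : `|t - s| <= e / 2.
    by near: s; apply: cvgr_dist_le; [exact: cvg_id|rewrite divr_gt0].
  have := lip s t; have := lip t s; rewrite (distrC s t) => h1 h2 h3.
  by rewrite ler_norml; apply/andP; split; lra.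
have f0 : f 0 = 0 by rewrite /f normr0 ab mdistxx.
have fa : f a = mdist (al a) (be a) by rewrite /f ger0_norm// ltW.
have [||b] := @IVT _ f 0 a A (ltW a0).
- exact: continuous_subspaceT.
- by rewrite f0 fa ge_min (ltW A0)/= le_max (ltW hA) orbT.
move=> /itvP hb fb; exists `|b|; last exact: fb.
rewrite normr_gt0; apply/eqP => b0; move: fb; rewrite b0 f0 => h.
by move: A0; rewrite -h ltxx.
Unshelve. all: by end_near. Qed.

Lemma bdist_le al be a : al 0 = x0 -> be 0 = x0 -> 0 < a ->
  (bdist A x0 (bclass al) (bclass be) <= a^-1) =
  (mdist (al a) (be a) <= A).
Proof.
move=> al0 be0 a0; have ab : al 0 = be 0 by rewrite al0 be0.
rewrite /bdist; case: pselect => [h|h].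
  case: cid => a' /= [a'0 [al' [be' [al'0 be'0]]]].
  move=> /bclass_eqP ha /bclass_eqP hb.
  rewrite (ray_unique _ ha) ?al0 ?(ltW a'0)//.
  rewrite (ray_unique _ hb) ?be0 ?(ltW a'0)// => hA.
  rewrite lef_pV2//; apply/idP/idP => [aa'|].
    have := @ray_convex al be a a' ab; rewrite (ltW a0) aa' hA => /(_ isT).
    move=> h1; rewrite -(ler_pM2l a'0); apply: (le_trans h1).
    by rewrite ler_wpM2r// ltW.
  move=> h1; rewrite leNgt; apply/negP => a'a.
  have := @ray_convex al be a' a ab; rewrite (ltW a'0) (ltW a'a) hA => /(_ isT).
  have : a' * mdist (al a) (be a) <= a' * A by rewrite ler_wpM2l// ltW.
  have : a' * A < a * A by rewrite ltr_pM2r.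
  lra.
rewrite invr_ge0 (ltW a0); apply/esym; rewrite leNgt; apply/negP => hA.
have [b b0 hb] := exists_meets ab a0 hA.
by apply: h; exists b; split => //; exists al, be; split.
Qed.

Lemma bdist_ge0 xi zeta : 0 <= bdist A x0 xi zeta.
Proof.
rewrite /bdist; case: pselect => // h; case: cid => a /= [a0 _].
by rewrite invr_ge0 ltW.
Qed.

Lemma bdist_le0 xi zeta :
  (forall a, 0 < a -> bdist A x0 xi zeta <= a^-1) -> bdist A x0 xi zeta = 0.
Proof.
move=> h; apply/eqP; rewrite eq_le bdist_ge0 andbT.
apply/ler_addgt0Pl => e e0; rewrite addr0 -[e]invrK.
by apply: h; rewrite invr_gt0.
Qed.

Lemma bdistxx xi : bdist A x0 xi xi = 0.
Proof.
have [al [al0 <-]] := exists_repr x0 xi.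
by apply: bdist_le0 => a a0; rewrite bdist_le// mdistxx ltW.
Qed.

Lemma bdist_positivity xi zeta : bdist A x0 xi zeta = 0 -> xi = zeta.
Proof.
have [al [al0 <-]] := exists_repr x0 xi.
have [be [be0 <-]] := exists_repr x0 zeta.
move=> h; apply/bclass_eqP; exists A => t; rewrite le_eqVlt => /orP[/eqP<-|t0].
  by rewrite al0 be0 mdistxx ltW.
by rewrite -bdist_le// h invr_ge0 ltW.
Qed.

Lemma bdist_sym xi zeta : bdist A x0 xi zeta = bdist A x0 zeta xi.
Proof.
have [al [al0 <-]] := exists_repr x0 xi.
have [be [be0 <-]] := exists_repr x0 zeta.
suff le_sym al' be' : al' 0 = x0 -> be' 0 = x0 ->
    bdist A x0 (bclass al') (bclass be') <= bdist A x0 (bclass be') (bclass al').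
  by apply/eqP; rewrite eq_le !le_sym.
move=> {al al0 be be0} al0 be0; apply/ler_addgt0Pl => e e0.
set d := bdist _ _ (bclass be') _.
have de : 0 < e + d by rewrite ltr_wpDr ?bdist_ge0.
rewrite -[leRHS]invrK bdist_le ?invr_gt0// metric_sym -bdist_le ?invr_gt0//.
by rewrite invrK lerDr ltW.
Qed.

Lemma bdist_triangle zeta xi om :
  bdist A x0 xi om <= bdist A x0 xi zeta + bdist A x0 zeta om.
Proof.
have [al [al0 <-]] := exists_repr x0 xi.
have [be [be0 <-]] := exists_repr x0 zeta.
have [ga [ga0 <-]] := exists_repr x0 om.
set p := bdist _ _ _ (bclass be); set q := bdist _ _ (bclass be) _.
apply/ler_addgt0Pl => e e0.
pose p' := p + e / 2; pose q' := q + e / 2.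
have p0 : 0 <= p by exact: bdist_ge0.
have q0 : 0 <= q by exact: bdist_ge0.
have p'0 : 0 < p' by rewrite /p'; lra.
have q'0 : 0 < q' by rewrite /q'; lra.
have -> : e + (p + q) = (p' + q')^-1^-1 by rewrite invrK /p' /q'; lra.
have s0 : 0 < (p' + q')^-1 by rewrite invr_gt0 addr_gt0.
rewrite bdist_le//; set s := _^-1 in s0 *.
have hp : mdist (al p'^-1) (be p'^-1) <= A.
  by rewrite -bdist_le ?invr_gt0// invrK lerDl divr_ge0// ltW.
have hq : mdist (be q'^-1) (ga q'^-1) <= A.
  by rewrite -bdist_le ?invr_gt0// invrK lerDl divr_ge0// ltW.
have sp : 0 <= s <= p'^-1.
  by rewrite (ltW s0)/= /s lef_pV2 ?posrE//; lra.
have sq : 0 <= s <= q'^-1.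
  by rewrite (ltW s0)/= /s lef_pV2 ?posrE//; lra.
have := @ray_convex al be s _ _ sp; rewrite al0 be0 => /(_ erefl) h1.
have := @ray_convex be ga s _ _ sq; rewrite ga0 be0 => /(_ erefl) h2.
have {}h1 : mdist (al s) (be s) <= p' * (s * A).
  rewrite -ler_pdivrMl//; apply: (le_trans h1).
  by rewrite ler_wpM2l// ltW.
have {}h2 : mdist (be s) (ga s) <= q' * (s * A).
  rewrite -ler_pdivrMl//; apply: (le_trans h2).
  by rewrite ler_wpM2l// ltW.
apply: (le_trans (metric_triangle _ (be s) _)).
apply: (le_trans (lerD h1 h2)).
by rewrite -mulrDl mulrA divff ?mul1r// gt_eqF// addr_gt0.
Qed.

End bdist_metric.
End boundary_metric.

Definition boundary_at (R : realType) (X : completeCAT0Type R)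
  (A : {posnum R}) (x0 : X) : Type := boundary X.

Section boundary_at_metric.
Context {R : realType} {X : completeCAT0Type R} (A : {posnum R}) (x0 : X).

HB.instance Definition _ := Choice.on (boundary_at A x0).
HB.instance Definition _ := @isMetric.Build R (boundary_at A x0)
  (bdist A%:num x0) (bdistxx x0 (gt0 A)) (@bdist_positivity _ _ _ x0 (gt0 A))
  (bdist_sym x0 (gt0 A)) (bdist_triangle x0 (gt0 A)).

End boundary_at_metric.

Definition homeomorphism (T U : topologicalType) (f : T -> U) : Prop :=
  exists g : U -> T, [/\ cancel f g, cancel g f, continuous f & continuous g].

Section quasi_symmetry.
Context {R : realType}.

Definition half_line : set R := `[0, +oo[.

(* The empty map into the empty space does not count as constant. *)
Definition quasi_symmetric (Y Z : metricType R) (f : Y -> Z) : Prop :=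
  ~ (exists z0, forall y, f y = z0) /\
  exists2 eta : half_line -> half_line, homeomorphism eta &
    forall (x y z : Y) (t : half_line),
      mdist x z <= \val t * mdist y z ->
      mdist (f x) (f z) <= \val (eta t) * mdist (f y) (f z).

Definition quasi_symmetry (Y Z : metricType R) (f : Y -> Z) : Prop :=
  quasi_symmetric f /\ homeomorphism f.

End quasi_symmetry.

Section group_actions.
Local Open Scope group_scope.

(* H ranges over all subsets of G, since every Prop is reflected in bool. *)
Definition finitely_generated (G : groupType) : Prop :=
  exists S : seq G, forall H : {pred G},
    group_closed H -> {subset S <= H} -> forall g, g \in H.

Record isometric_action (R : realType) (G : groupType) (X : metricType R) :=
  IsometricAction {
    act_fun :> G -> X -> X;
    act1 : forall x, act_fun 1 x = x;
    actM : forall g h x, act_fun (g * h) x = act_fun g (act_fun h x);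
    act_isom : forall g x y, mdist (act_fun g x) (act_fun g y) = mdist x y
  }.

End group_actions.

Section boundary_action.
Context {R : realType} {G : groupType} {X : metricType R}.
Variable act : isometric_action G X.

Lemma ray_act_subproof g (al : ray X) s t : 0 <= s -> 0 <= t ->
  mdist (act g (al s)) (act g (al t)) = `|s - t|.
Proof. by move=> s0 t0; rewrite act_isom ray_isom. Qed.

Definition ray_act g (al : ray X) : ray X := Ray (ray_act_subproof g al).

Definition boundary_act g (xi : boundary X) : boundary X :=
  bclass (ray_act g (repr xi)).

Lemma boundary_actE g al : boundary_act g (bclass al) = bclass (ray_act g al).
Proof.
apply/bclass_eqP.
have /bclass_eqP[k hk] : bclass (repr (bclass al)) = bclass al.
  exact: bclassK.
by exists k => t t0; rewrite /= act_isom hk.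
Qed.

Lemma boundary_act1 xi : boundary_act 1%g xi = xi.
Proof.
rewrite -[xi]bclassK boundary_actE; apply/bclass_eqP.
by exists 0 => t t0 /=; rewrite act1 mdistxx.
Qed.

Lemma boundary_actM g h xi :
  boundary_act (g * h)%g xi = boundary_act g (boundary_act h xi).
Proof.
rewrite -[xi]bclassK !boundary_actE; apply/bclass_eqP.
by exists 0 => t t0 /=; rewrite actM mdistxx.
Qed.

End boundary_action.

(* Main.v *)
Require Import Defs.
From mathcomp Require Import all_boot all_order all_algebra.
From mathcomp Require Import all_classical all_reals all_analysis.
From mathcomp Require Import lra ring.

(** The distance between asymptotic rays of a CAT(0) space is a bounded convex
    function of time, hence it never exceeds its initial value. So replacing
    the base point [x0] by [x1] moves every point of every ray by at most
    [D = mdist x0 x1], and two rays that are at distance at most [A] at time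
    [a] become two rays at distance at most [A + 2 D] at time [a]. Convexity
    again, now for two rays with a common origin, brings the distance down to
    [A] at the smaller time [a / (1 + 2 D / A)]: the metrics of the boundary
    based at [x0] and [x1] differ by a factor of at most [1 + 2 D / A]
    ([bdist_basepoint]).

    An isometry [g] carries the metric based at [x0] to the metric based at
    [g x0] ([bdist_act]), so [g] acts on the boundary by a Lipschitz map
    ([boundary_act_lipschitz]), and so does its inverse. A bijection which is
    Lipschitz both ways with constants [K] and [L] is a homeomorphism, and when
    its target is not a single point it is quasi-symmetric with the linear
    distortion [eta t = K L t] ([bilipschitz_quasi_symmetry]). *)

Set Implicit Arguments.
Unset Strict Implicit.
Unset Printing Implicit Defensive.

Import Order.TTheory GRing.Theory Num.Theory.
Import numFieldNormedType.Exports.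

Local Open Scope classical_set_scope.
Local Open Scope ring_scope.

Section lipschitz.
Context {R : realType}.

Lemma lipschitz_continuous (Y Z : metricType R) (f : Y -> Z) (K : R) :
  0 < K -> (forall x y, mdist (f x) (f y) <= K * mdist x y) -> continuous f.
Proof.
move=> K0 fK y; apply/metricType_numDomainType.cvgrPdist_lt => e e0.
near=> z; apply: le_lt_trans (fK _ _) _; rewrite -ltr_pdivlMl//.
near: z.
have := @cvg_id _ (nbhs y).
by move=> /metricType_numDomainType.cvgrPdist_lt; apply; rewrite mulr_gt0 ?invr_gt0.
Unshelve. all: by end_near. Qed.

Lemma half_line_scale_subproof (K : R) (t : half_line) : 0 < K ->
  K * \val t \in (half_line : set R).
Proof.
move=> K0; have := set_valP t; rewrite /half_line /= in_itv/= andbT => t0.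
by rewrite inE /half_line /= in_itv/= andbT mulr_ge0// ltW.
Qed.

Definition half_line_scale (K : R) (K0 : 0 < K) (t : half_line) : half_line :=
  SigSub (half_line_scale_subproof t K0).

Lemma half_line_scale_continuous (K : R) (K0 : 0 < K) :
  continuous (half_line_scale K0).
Proof.
apply: continuous_comp_initial => t.
apply: (@cvg_comp _ _ _ set_val ( *%R K)).
  exact: initial_continuous.
exact: mulrl_continuous.
Qed.

Lemma half_line_scale_homeomorphism (K : R) (K0 : 0 < K) :
  homeomorphism (half_line_scale K0).
Proof.
have Ki : 0 < K^-1 by rewrite invr_gt0.
exists (half_line_scale Ki); split.
- by move=> t; apply: val_inj; rewrite /= mulKf// gt_eqF.
- by move=> t; apply: val_inj; rewrite /= mulVKf// gt_eqF.
- exact: half_line_scale_continuous.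
- exact: half_line_scale_continuous.
Qed.

Lemma bilipschitz_quasi_symmetry (Y Z : metricType R) (f : Y -> Z) (g : Z -> Y)
    (K L : R) :
  cancel f g -> cancel g f -> 0 < K -> 0 < L ->
  (forall x y, mdist (f x) (f y) <= K * mdist x y) ->
  (forall x y, mdist (g x) (g y) <= L * mdist x y) ->
  ~ (exists z0 : Z, forall z, z = z0) ->
  quasi_symmetry f.
Proof.
move=> fgK gfK K0 L0 fK gL nZ; split; last first.
  exists g; split => //.
  - exact: lipschitz_continuous K0 fK.
  - exact: lipschitz_continuous L0 gL.
split.
  by move=> [z0 fz0]; apply: nZ; exists z0 => z; rewrite -(gfK z).
have KL0 : 0 < K * L by rewrite mulr_gt0.
exists (half_line_scale KL0); first exact: half_line_scale_homeomorphism.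
move=> x y z t xz; apply: le_trans (fK _ _) _.
rewrite /= -!mulrA ler_pM2l//; apply: le_trans xz _.
rewrite mulrCA ler_wpM2l//.
  by have := set_valP t; rewrite /half_line /= in_itv/= andbT.
by rewrite -{1}(fgK y) -{1}(fgK z).
Qed.

(** Meant for [q] and [p] boundary distances: [bdist_le] translates a
    comparison of such a distance with [a^-1] into one between points of rays
    at time [a], whatever the value of the distance. *)
Lemma le_from_inv_bounds (K p q : R) : 0 < K -> 0 <= p ->
  (forall a, 0 < a -> p <= a^-1 -> q <= K * a^-1) -> q <= K * p.
Proof.
move=> K0 p0 h; rewrite -ler_pdivrMl//; apply/ler_addgt0Pr => e e0.
have pe : 0 < p + e by lra.
rewrite ler_pdivrMl// -[p + e]invrK; apply: h; rewrite ?invr_gt0//.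
by rewrite invrK lerDl ltW.
Qed.

End lipschitz.

Section boundary_metric.
Context {R : realType} {X : completeCAT0Type R}.
Implicit Types (al be : ray X) (xi zeta : boundary X).

(** Compare both rays with the geodesic from [al 0] to [be T] for a large [T]:
    at the proportion [t / T] of the way, the point of that geodesic is within
    [mdist (al 0) (be 0)] of [be t], and within [t / T] times the bound on the
    distance of the rays of [al t]. *)
Lemma asymptotic_dist al be t : asymptotic al be -> 0 <= t ->
  mdist (al t) (be t) <= mdist (al 0) (be 0).
Proof.
move=> [k hk] t0; set D := mdist (al 0) _; apply/ler_addgt0Pr => e e0.
have k0 : 0 <= k by exact: le_trans (mdist_ge0 _ _) (hk 0 (lexx _)).
(* T is past t and so large that t / T * k is at most e. *)
pose T := t + 1 + t * k / e.
have q0 : 0 <= t * k / e by rewrite divr_ge0 ?mulr_ge0// ltW.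
have T0 : 0 < T by rewrite /T; lra.
pose u := t / T.
have u01 : 0 <= u <= 1.
  by rewrite /u divr_ge0 ?(ltW T0)//= ler_pdivrMr// mul1r /T; lra.
have uT : u * T = t by rewrite /u divfK// gt_eqF.
have uk : u * k <= e.
  rewrite /u mulrAC ler_pdivrMr// -ler_pdivrMl// mulrC /T; lra.
have [c gc] := (@cat0P R X).1 (al 0) (be T).
have := cat0_convex (ray_geodesicP al (ltW T0)) gc u01.
rewrite ray_geodesic ?(ltW T0)// uT => h1.
have u01' : 0 <= 1 - u <= 1 by case/andP: u01 => ? ?; apply/andP; split; lra.
have := cat0_convex (geodesic_rev gc)
  (geodesic_rev (ray_geodesicP be (ltW T0))) u01'.
rewrite (metric_sym (be T) (al 0)) (metric_sym (be T) (be 0)).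
rewrite ray_geodesic ?(ltW T0)//.
have -> : T - (1 - u) * T = t by rewrite -uT; ring.
set l := mdist (al 0) (be T) in h1 *.
have -> : l - (1 - u) * l = u * l by ring.
rewrite -/D => h2.
have h3 : u * mdist (al T) (be T) <= u * k.
  by rewrite ler_wpM2l ?hk ?(ltW T0)//; case/andP: u01.
have h4 : (1 - u) * D <= D.
  by rewrite -[leRHS]mul1r ler_wpM2r ?mdist_ge0//; case/andP: u01'.
have := metric_triangle (al t) (c (u * l)) (be t); lra.
Qed.

(** The factor is the slowdown [L] of time that makes up for the change of
    rays: at time [a] the new rays are at distance at most [A + 2 D = L A], so
    by convexity they are at distance at most [A] at time [a / L]. *)
Lemma bdist_basepoint (A : R) (x0 x1 : X) xi zeta : 0 < A ->
  bdist A x1 xi zeta <= (1 + 2 * mdist x0 x1 / A) * bdist A x0 xi zeta.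
Proof.
move=> A0; set D := mdist x0 x1; set L := 1 + _.
have D0 : 0 <= D by exact: mdist_ge0.
have L1 : 1 <= L by rewrite lerDl divr_ge0 ?(ltW A0)// mulr_ge0.
have L0 : 0 < L by lra.
have [al [al0 xiE]] := exists_repr x0 xi.
have [be [be0 zetaE]] := exists_repr x0 zeta.
have [al' [al'0 xiE']] := exists_repr x1 xi.
have [be' [be'0 zetaE']] := exists_repr x1 zeta.
apply: le_from_inv_bounds => //; first exact: bdist_ge0.
move=> a a0; rewrite -{1}xiE -{1}zetaE bdist_le// => hA.
have -> : L * a^-1 = (a / L)^-1 by rewrite invfM invrK mulrC.
rewrite -xiE' -zetaE' bdist_le ?divr_gt0//.
have asym (ga ga' : ray X) om : ga 0 = x0 -> ga' 0 = x1 ->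
    bclass ga = om -> bclass ga' = om -> mdist (ga a) (ga' a) <= D.
  move=> ga0 ga'0 <- /esym/bclass_eqP h.
  by rewrite /D -ga0 -ga'0; apply: asymptotic_dist => //; exact: ltW.
have ha := asym _ _ _ al0 al'0 xiE xiE'.
have hb := asym _ _ _ be0 be'0 zetaE zetaE'.
have ha' : mdist (al' a) (be' a) <= L * A.
  have -> : L * A = A + 2 * D by rewrite /L; field; rewrite gt_eqF.
  have := metric_triangle (al' a) (al a) (be' a).
  have := metric_triangle (al a) (be a) (be' a).
  rewrite (metric_sym (al' a) (al a)); lra.
have saL : 0 <= a / L <= a.
  by rewrite divr_ge0 ?(ltW a0) ?(ltW L0)//= ler_pdivrMr// ler_peMr// ltW.
have := @ray_convex _ _ al' be' _ _ _ saL; rewrite al'0 be'0 => /(_ erefl) h.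
rewrite -(ler_pM2l a0); apply: le_trans h _.
apply: (@le_trans _ _ (a / L * (L * A))).
  by rewrite ler_wpM2l//; case/andP: saL.
by rewrite mulrA divfK// gt_eqF.
Qed.

Section action.
Context {G : groupType} (act : isometric_action G X).

Lemma bdist_act (A : R) (x0 : X) g xi zeta : 0 < A ->
  bdist A (act g x0) (boundary_act act g xi) (boundary_act act g zeta) =
  bdist A x0 xi zeta.
Proof.
move=> A0; have [al [al0 <-]] := exists_repr x0 xi.
have [be [be0 <-]] := exists_repr x0 zeta; rewrite !boundary_actE.
set p := bdist _ _ _ _; set q := bdist _ _ _ _.
have pq a : 0 < a -> (p <= a^-1) = (q <= a^-1).
  by move=> a0; rewrite /p /q !bdist_le//= ?act_isom// ?al0 ?be0.
have le_by_bounds (r s : R) : 0 <= s ->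
    (forall a, 0 < a -> (r <= a^-1) = (s <= a^-1)) -> r <= s.
  move=> s0 rs; rewrite -[s]mul1r; apply: le_from_inv_bounds => // a a0.
  by rewrite mul1r rs.
apply/eqP; rewrite eq_le; apply/andP.
by split; apply: le_by_bounds => [|a a0]; rewrite ?pq//; exact: bdist_ge0.
Qed.

(** The distance based at [x0] of the images is compared with the one based at
    [g x0], which is the original distance. *)
Lemma boundary_act_lipschitz (A : R) (x0 : X) g xi zeta : 0 < A ->
  bdist A x0 (boundary_act act g xi) (boundary_act act g zeta) <=
  (1 + 2 * mdist (act g x0) x0 / A) * bdist A x0 xi zeta.
Proof. by move=> A0; rewrite -(bdist_act x0 g xi zeta A0) bdist_basepoint. Qed.

End action.
End boundary_metric.

Theorem theorem3p1p5 (R : realType) (G : groupType)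
    (hG : finitely_generated G) (X : completeCAT0Type R)
    (act : isometric_action G X) (x0 : X) (A : {posnum R})
    (hX : ~ exists xi : boundary X, forall zeta : boundary X, zeta = xi)
    (g : G) :
  quasi_symmetry
    (boundary_act act g : boundary_at A x0 -> boundary_at A x0).
Proof.
have pos h : 0 < 1 + 2 * mdist (act h x0) x0 / A%:num.
  by rewrite ltr_pwDl// divr_ge0// mulr_ge0// mdist_ge0.
apply: (@bilipschitz_quasi_symmetry _ _ _ _
  (boundary_act act g^-1%g : boundary_at A x0 -> boundary_at A x0) _ _
  _ _ (pos g) (pos g^-1%g)) => //.
- by move=> xi; rewrite -boundary_actM mulVg boundary_act1.
- by move=> xi; rewrite -boundary_actM mulgV boundary_act1.
- by move=> xi zeta; exact: boundary_act_lipschitz.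
- by move=> xi zeta; exact: boundary_act_lipschitz.
Qed.
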